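(* Let $\alpha^{\top}x\le\beta^{\top}y+\gamma$ (with $\alpha\in\mathbb{R}^{|Q|}$, $\beta\in\mathbb{R}^{|T|}$, $\gamma\in\mathbb{R}$) be a nontrivial facet-defining inequality of $P$. Then (i) $\alpha_q\ge 0$ and $\alpha_q\le\lceil a_q/b_t\rceil\beta_t$ for each $q\in Q$ and $t\in T$; (ii) $0<\beta_t\le\lceil b_t/b_k\rceil\beta_k$ for each $t,k\in T$ with $t\ne k$; (iii) if $c\ge 0$, then $\gamma\ge 0$; otherwise $\gamma\ge-\lceil -c/b_t\rceil\beta_t$ for all $t\in T$.
   Context: $Q$ is a finite set, $T=\{1,\ldots,|T|\}\ne\varnothing$, $0<b_1\le\cdots\le b_{|T|}$ are real numbers, $a_q>0$ for all $q\in Q$, $c\in\mathbb{R}$, and $\sum_{q\in Q}a_q-c>0$. The unsplittable flow arc-set is $$X=\Big\{(x,y)\in\{0,1\}^{|Q|}\times\mathbb{Z}_+^{|T|}:\ \sum_{q\in Q}a_qx_q\le\sum_{t\in T}b_ty_t+c\Big\},$$ and $P=\mathrm{conv}(X)$ is the unsplittable flow arc-set polyhedron (it is full dimensional, so each facet-defining inequality is determined by its facet up to a positive multiple). The trivial inequalities of $P$ are $x_q\ge 0$ and $x_q\le 1$ ($q\in Q$), $y_t\ge 0$ ($t\in T$), and $\sum_{q\in Q}a_qx_q\le\sum_{t\in T}b_ty_t+c$; a facet-defining inequality is nontrivial if it is not (a positive multiple of) one of these. *)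

(* Defs.v *)
(* MathComp / MathComp-Analysis (R : realType). *)
From HB Require Import structures.
From mathcomp Require Import all_boot all_order all_algebra.
From mathcomp Require Import classical_sets reals.

Set Implicit Arguments.
Unset Strict Implicit.
Unset Printing Implicit Defensive.

Import Order.TTheory GRing.Theory Num.Theory.

Local Open Scope classical_set_scope.
Local Open Scope ring_scope.

Definition conv_hull (R : realType) (V : lmodType R) (A : set V) : set V :=
  [set v | exists (n : nat) (l : 'I_n -> R) (p : 'I_n -> V),
    [/\ forall i, 0 <= l i, \sum_(i < n) l i = 1, forall i, A (p i)
      & v = \sum_(i < n) l i *: p i]].

(* The points p0, ..., pk are affinely independent iff p1 - p0, ..., pk - p0
   are linearly independent. *)
Definition affinely_independent (R : realType) (V : vectType R) (s : seq V) :=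
  free [seq v - head 0 s | v <- behead s].

(* The affine dimension of A is d: the maximal number of affinely independent
   points of A is d + 1.  The empty set (dimension -1) has no dimension here. *)
Definition has_aff_dim (R : realType) (V : vectType R) (A : set V) (d : nat) :=
  (exists s : seq V, [/\ affinely_independent s, forall v, v \in s -> A v
                       & size s = d.+1])
  /\ (forall s : seq V, affinely_independent s -> (forall v, v \in s -> A v) ->
        (size s <= d.+1)%N).

(* R^Q x R^T with T = {0, ..., m - 1}; R^o is R seen as a vector space over
   itself. *)
Definition space (R : realType) (Q : finType) (m : nat) : vectType R :=
  ({ffun Q -> R^o} * {ffun 'I_m -> R^o})%type.

Section UnsplittableFlow.
Variables (R : realType) (Q : finType) (m : nat).
Variables (a : Q -> R) (b : 'I_m -> R) (c : R).
Implicit Types (alpha : Q -> R) (beta : 'I_m -> R) (gamma : R).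

Definition X : set (space R Q m) :=
  [set z : space R Q m | [/\ forall q : Q, z.1 q = 0 \/ z.1 q = 1,
               forall t : 'I_m, (z.2 t : R) \is a Num.nat
             & \sum_q a q * z.1 q <= \sum_t b t * z.2 t + c]].

Definition P : set (space R Q m) := conv_hull X.

(* Below, (alpha, beta, gamma) stands for the inequality
   alpha^T x <= beta^T y + gamma. *)

Definition valid alpha beta gamma :=
  forall z, P z ->
    \sum_q alpha q * z.1 q <= \sum_t beta t * z.2 t + gamma.

Definition face alpha beta gamma : set (space R Q m) :=
  [set z : space R Q m | P z /\ \sum_q alpha q * z.1 q = \sum_t beta t * z.2 t + gamma].

Definition facet_defining alpha beta gamma :=
  valid alpha beta gamma /\
  exists d : nat, has_aff_dim P d.+1 /\ has_aff_dim (face alpha beta gamma) d.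

Definition positive_multiple alpha beta gamma
    (alpha' : Q -> R) (beta' : 'I_m -> R) (gamma' : R) :=
  exists2 k : R, 0 < k &
    [/\ forall q, alpha q = k * alpha' q, forall t, beta t = k * beta' t
      & gamma = k * gamma'].

(* In order: x_q >= 0, x_q <= 1, y_t >= 0 and the capacity inequality. *)
Definition trivial_inequality alpha beta gamma :=
  [\/ exists q, positive_multiple alpha beta gamma
                  (fun r => - (r == q)%:R) (fun=> 0) 0,
      exists q, positive_multiple alpha beta gamma
                  (fun r => (r == q)%:R) (fun=> 0) 1,
      exists t, positive_multiple alpha beta gamma
                  (fun=> 0) (fun s => (s == t)%:R) 0
    | positive_multiple alpha beta gamma a b c].

End UnsplittableFlow.

(* Main.v *)
Require Import Defs.
From HB Require Import structures.
From mathcomp Require Import all_boot all_order all_algebra.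
From mathcomp Require Import classical_sets reals.
From mathcomp Require Import boolp lra.

Set Implicit Arguments.
Unset Strict Implicit.
Unset Printing Implicit Defensive.

Import Order.TTheory GRing.Theory Num.Theory.

Local Open Scope classical_set_scope.
Local Open Scope ring_scope.

(** Two kinds of facts about an inequality [alpha x <= beta y + gamma] that
    defines a facet are combined.

    The first is exchange.  If a point of [X] is tight and a small change of
    it stays in [X], then validity at the new point bounds the coefficients
    that changed.  Setting [x_q] from 1 to 0 gives [alpha_q >= 0]; setting
    [x_q] from 0 to 1 and paying for it with [ceil (a_q / b_t)] further units
    of [y_t] gives the upper bound on [alpha_q]; trading one unit of [y_t] for
    [ceil (b_t / b_k)] units of [y_k] gives the upper bound on [beta_t].
    Part (iii) is validity at the origin, or at the multiple of the [t]-th unit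
    vector that just covers [- c].

    The second is the existence of tight points at which these moves start:
    points with [x_q = 1], with [x_q = 0], with [y_t > 0]
    ([facet_tight_point]).  If every tight point of [X] were also tight for
    [x_q >= 0], say, then so would be the whole facet, as a tight point of the
    convex hull is a combination of tight points of [X].  But a facet determines
    its inequality up to a positive factor: the affine span of [P] has one
    dimension more than that of the facet, so two affine functions that vanish
    on the facet are proportional on [P] ([affine_forms_proportional]), and an
    affine function that vanishes on [X] has zero coefficients
    ([slack0_coef]).  So the inequality would be trivial.

    Finally, [beta_t >= 0] since [y_t] is unbounded in [X], and [beta_t = 0]
    would force all [alpha_q] and all [beta_k] to vanish by the bounds already
    obtained; the facet would then be all of [P], contrary to its dimension. *)

(** * Affine dimension and supporting hyperplanes *)

Lemma span_form0 (R : realType) (V : vectType R) (D : seq V)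
    (h : {linear V -> R^o}) (z : V) :
  (forall v, v \in D -> h v = 0) -> z \in <<D>>%VS -> h z = 0.
Proof.
move=> hD zD; have : (<<D>> <= lker (linfun h))%VS.
  by apply/span_subvP => v vD; rewrite memv_ker lfunE /= hD.
by move/subvP/(_ _ zD); rewrite memv_ker lfunE /= => /eqP.
Qed.

Lemma span_line_form (R : realType) (V : vectType R) (D : seq V) (w z : V) :
  z \in <<w :: D>>%VS ->
  exists k : R, forall h : {linear V -> R^o},
    (forall v, v \in D -> h v = 0) -> h z = k * h w.
Proof.
rewrite span_cons => /memv_addP [x /vlineP [k ->] [y yD ->]].
exists k => h hD.
by rewrite linearD linearZ /= (span_form0 hD yD) addr0.
Qed.

(** A facet is a proper subset: the dimensions differ. *)
Lemma aff_dim_proper (R : realType) (V : vectType R) (A F : set V) (d : nat) :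
  has_aff_dim A d.+1 -> has_aff_dim F d -> ~ (forall z, A z -> F z).
Proof.
move=> [[s [sfree sA ssize]] _] [_ Fmax] AF.
by have := Fmax s sfree (fun v vs => AF v (sA v vs)); rewrite ssize ltnn.
Qed.

(** For [p] off the hyperplane [f = u], the point [p] and an affine basis
    [s0 :: s] of [F] already form an affine basis of [A], by the dimension
    hypotheses.  So for [p'] in [A], the vector [p' - s0] agrees with a multiple
    of [p - s0] up to directions of [F], and both forms vanish on the latter. *)
Lemma affine_forms_proportional (R : realType) (V : vectType R) (A F : set V)
    (d : nat) (f g : {linear V -> R^o}) (u v : R) :
  has_aff_dim A d.+1 -> has_aff_dim F d ->
  (forall z, F z <-> A z /\ f z = u) -> (forall z, F z -> g z = v) ->
  forall p p', A p -> A p' -> (f p - u) * (g p' - v) = (g p - v) * (f p' - u).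
Proof.
move=> [_ Amax] [[s1 [+ + +]] _] FA Fg p p' Ap Ap'.
case: s1 => [//|s0 s] sfree sF /succn_inj ssize.
have [fpu|fpu] := eqVneq (f p) u.
  have gpv : g p = v by apply/Fg/FA.
  by rewrite fpu gpv !subrr !mul0r.
have s0F : F s0 by apply: sF; rewrite mem_head.
have [s0A fs0] := (FA s0).1 s0F.
have gs0 := Fg s0 s0F.
pose D := [seq x - s0 | x <- s].
have fD w : w \in D -> f w = 0.
  move=> /mapP [x xs ->]; rewrite linearB /= fs0.
  by have /FA [_ ->] := sF x (mem_behead (s := s0 :: s) xs); rewrite subrr.
have gD w : w \in D -> g w = 0.
  move=> /mapP [x xs ->]; rewrite linearB /= gs0.
  by rewrite (Fg x (sF x (mem_behead (s := s0 :: s) xs))) subrr.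
have pfree : free ((p - s0) :: D).
  rewrite free_cons; apply/andP; split; last exact: sfree.
  apply: contra_neqN fpu => pD.
  by have /eqP := span_form0 fD pD; rewrite linearB /= fs0 subr_eq0 => /eqP.
have p'D : p' - s0 \in <<(p - s0) :: D>>%VS.
  apply: contraT => p'D.
  have /Amax : affinely_independent [:: s0, p', p & s].
    by rewrite /affinely_independent /= free_cons p'D.
  suff sA : forall x, x \in [:: s0, p', p & s] -> A x.
    by move=> /(_ sA); rewrite ltnS ltnS -ssize ltnn.
  move=> x; rewrite !inE => /or4P [/eqP ->|/eqP ->|/eqP ->|xs] //.
  by have /FA [] := sF x (mem_behead (s := s0 :: s) xs).
have [k kP] := span_line_form p'D.
have := kP f fD; have := kP g gD.
rewrite !linearB /= fs0 gs0 => -> ->.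
by rewrite mulrCA [RHS]mulrCA [in RHS](mulrC (g p - v)).
Qed.

(** * Slack of an inequality *)

Section Slack.
Context {R : realType} {Q : finType} {m : nat}.
Implicit Types (alpha : Q -> R) (beta : 'I_m -> R) (gamma : R).
Implicit Types (z w : Defs.space R Q m).

Definition slack_form alpha beta z : R^o :=
  \sum_t beta t * z.2 t - \sum_q alpha q * z.1 q.

Lemma slack_form_is_linear alpha beta : linear (slack_form alpha beta).
Proof.
move=> k z w; rewrite /slack_form.
have -> : \sum_t beta t * (k *: z + w).2 t =
    k * (\sum_t beta t * z.2 t) + \sum_t beta t * w.2 t.
  rewrite mulr_sumr -big_split /=; apply: eq_bigr => t _.
  by rewrite !ffunE mulrDr mulrCA.
have -> : \sum_q alpha q * (k *: z + w).1 q =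
    k * (\sum_q alpha q * z.1 q) + \sum_q alpha q * w.1 q.
  rewrite mulr_sumr -big_split /=; apply: eq_bigr => q _.
  by rewrite !ffunE mulrDr mulrCA.
by rewrite /GRing.scale /= mulrBr opprD addrACA.
Qed.

HB.instance Definition _ alpha beta :=
  GRing.isLinear.Build R (Defs.space R Q m) R^o _ (slack_form alpha beta)
    (slack_form_is_linear alpha beta).

(** Right-hand side minus left-hand side: nonnegative on valid points and zero
    on tight ones.  Validity then becomes a statement about the sign of an affine
    function, computable along unit vectors and on convex combinations. *)
Definition slack alpha beta gamma z : R := slack_form alpha beta z + gamma.

Lemma slack_ge0 alpha beta gamma z :
  (0 <= slack alpha beta gamma z) =
  (\sum_q alpha q * z.1 q <= \sum_t beta t * z.2 t + gamma).
Proof. by rewrite /slack /slack_form addrAC subr_ge0. Qed.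

Lemma slack_eq0 alpha beta gamma z :
  (slack alpha beta gamma z == 0) =
  (\sum_q alpha q * z.1 q == \sum_t beta t * z.2 t + gamma).
Proof. by rewrite /slack /slack_form addrAC subr_eq0 eq_sym. Qed.

Definition unitQ (q : Q) : Defs.space R Q m := ([ffun r => (r == q)%:R], 0).
Definition unitT (t : 'I_m) : Defs.space R Q m := (0, [ffun s => (s == t)%:R]).

Lemma slack_form_unitQ alpha beta q :
  slack_form alpha beta (unitQ q) = - alpha q.
Proof.
rewrite /slack_form /= big1 => [|t _]; last by rewrite ffunE mulr0.
rewrite (bigD1 q) //= big1 => [|r /negPf rq]; last by rewrite ffunE rq mulr0.
by rewrite ffunE eqxx mulr1 addr0 sub0r.
Qed.

Lemma slack_form_unitT alpha beta t :
  slack_form alpha beta (unitT t) = beta t.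
Proof.
rewrite /slack_form /= [X in _ - X]big1 => [|q _]; last by rewrite ffunE mulr0.
rewrite (bigD1 t) //= big1 => [|s /negPf st]; last by rewrite ffunE st mulr0.
by rewrite ffunE eqxx mulr1 addr0 subr0.
Qed.

Lemma slack_at0 alpha beta gamma : slack alpha beta gamma 0 = gamma.
Proof. by rewrite /slack linear0 add0r. Qed.

Lemma slackD_unitQ alpha beta gamma z k q :
  slack alpha beta gamma (z + k *: unitQ q) =
  slack alpha beta gamma z - k * alpha q.
Proof.
by rewrite /slack linearD linearZ /= slack_form_unitQ scalerN addrAC.
Qed.

Lemma slackD_unitT alpha beta gamma z k t :
  slack alpha beta gamma (z + k *: unitT t) =
  slack alpha beta gamma z + k * beta t.
Proof. by rewrite /slack linearD linearZ /= slack_form_unitT addrAC. Qed.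

Lemma slack_x_ge0 q z : slack (fun r => - (r == q)%:R) (fun=> 0) 0 z = z.1 q.
Proof.
rewrite /slack /slack_form big1 => [|t _]; last by rewrite mul0r.
rewrite (bigD1 q) //= big1 => [|r /negPf ->]; last by rewrite oppr0 mul0r.
by rewrite eqxx mulN1r; lra.
Qed.

Lemma slack_x_le1 q z : slack (fun r => (r == q)%:R) (fun=> 0) 1 z = 1 - z.1 q.
Proof.
rewrite /slack /slack_form big1 => [|t _]; last by rewrite mul0r.
rewrite (bigD1 q) //= big1 => [|r /negPf ->]; last by rewrite mul0r.
by rewrite eqxx mul1r; lra.
Qed.

Lemma slack_y_ge0 t z : slack (fun=> 0) (fun s => (s == t)%:R) 0 z = z.2 t.
Proof.
rewrite /slack /slack_form [X in _ - X]big1 => [|q _]; last by rewrite mul0r.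
rewrite (bigD1 t) //= big1 => [|s /negPf ->]; last by rewrite mul0r.
by rewrite eqxx mul1r; lra.
Qed.

Lemma slackB alpha beta gamma alpha' beta' gamma' (k : R) z :
  slack (fun q => alpha q - k * alpha' q) (fun t => beta t - k * beta' t)
    (gamma - k * gamma') z =
  slack alpha beta gamma z - k * slack alpha' beta' gamma' z.
Proof.
rewrite /slack /slack_form.
under eq_bigr do rewrite mulrBl -mulrA.
under [in X in _ - X]eq_bigr do rewrite mulrBl -mulrA.
by rewrite !sumrB -!mulr_sumr; lra.
Qed.

Lemma slack_conv alpha beta gamma n (l : 'I_n -> R)
    (p : 'I_n -> Defs.space R Q m) :
  \sum_(i < n) l i = 1 ->
  slack alpha beta gamma (\sum_(i < n) l i *: p i) =
  \sum_(i < n) l i * slack alpha beta gamma (p i).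
Proof.
move=> l1; rewrite /slack linear_sum /= -[in LHS](mul1r gamma) -l1 mulr_suml.
by rewrite -big_split; apply: eq_bigr => i _; rewrite linearZ mulrDr.
Qed.

End Slack.

(** A move changes [y] by a natural number of units; this is how the ceilings
    in the bounds count such units. *)
Lemma ceil_ratio_nat (R : realType) (x y : R) : 0 <= x -> 0 < y ->
  exists n : nat, (Num.ceil (x / y))%:~R = n%:R :> R /\ x <= n%:R * y.
Proof.
move=> x_ge0 y_gt0; exists `|Num.ceil (x / y)|%N.
have ceilE : (Num.ceil (x / y))%:~R = `|Num.ceil (x / y)|%:R :> R.
  rewrite natr_absz ger0_norm // ceil_ge0.
  by rewrite (lt_le_trans (ltrN10 R)) ?divr_ge0 // ltW.
by split=> //; rewrite -ceilE -ler_pdivrMr // ceil_ge.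
Qed.

(** * Moves inside the arc-set *)

Section ArcSet.
Context {R : realType} {Q : finType} {m : nat}.
Variables (a : Q -> R) (b : 'I_m -> R) (c : R).
Implicit Types (alpha : Q -> R) (beta : 'I_m -> R) (gamma : R).
Implicit Types (z : Defs.space R Q m).

Lemma arc_setP z :
  X a b c z <-> [/\ forall q, z.1 q = 0 \/ z.1 q = 1,
    forall t, (z.2 t : R) \is a Num.nat & 0 <= slack a b c z].
Proof. by rewrite slack_ge0. Qed.

Lemma arc_set_sub_hull z : X a b c z -> P a b c z.
Proof.
move=> Xz; exists 1%N, (fun=> 1), (fun=> z); split=> //.
- by rewrite big_ord1.
- by rewrite big_ord1 scale1r.
Qed.

Lemma arc_set0 : 0 <= c -> X a b c 0.
Proof.
move=> c0; apply/arc_setP; split=> [q|t|]; last by rewrite slack_at0.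
- by left; rewrite ffunE.
- by rewrite ffunE.
Qed.

Hypothesis b_gt0 : forall t, 0 < b t.

Lemma arc_set_unitT z (n : nat) t :
  X a b c z -> X a b c (z + n%:R *: unitT t).
Proof.
move=> /arc_setP [zx zy zs]; apply/arc_setP; split.
- by move=> q; rewrite /= !ffunE scaler0 addr0.
- move=> s; rewrite /= !ffunE; apply: rpredD => //.
  by rewrite scaler_nat rpredMn // natr_nat.
- by rewrite slackD_unitT addr_ge0 // mulr_ge0 // ltW.
Qed.

Lemma arc_set_multiple (n : nat) t : - c <= n%:R * b t ->
  X a b c (n%:R *: unitT t).
Proof.
move=> cn; apply/arc_setP; split.
- by move=> q; left; rewrite /= !ffunE scaler0.
- by move=> s; rewrite /= !ffunE -[_ *: _]natrM.
- by rewrite -[_ *: _]add0r slackD_unitT slack_at0 addrC -lerBlDr sub0r.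
Qed.

Lemma arc_set_base t : exists n : nat, X a b c (n%:R *: unitT t).
Proof.
have [n [_ cn]] := ceil_ratio_nat (normr_ge0 c) (b_gt0 t); exists n.
by apply: arc_set_multiple; rewrite (le_trans _ cn) // -normrN ler_norm.
Qed.

Lemma arc_set_remove z q : 0 < a q ->
  X a b c z -> z.1 q = 1 -> X a b c (z + -1 *: unitQ q).
Proof.
move=> aq /arc_setP [zx zy zs] zq; apply/arc_setP; split.
- move=> r; rewrite /= !ffunE.
  have [->|_] := eqVneq r q; last by rewrite scaler0 addr0.
  by left; rewrite zq scaleN1r subrr.
- by move=> s; rewrite /= !ffunE scaler0 addr0.
- by rewrite slackD_unitQ mulN1r opprK addr_ge0 // ltW.
Qed.

Lemma arc_set_insert z q (n : nat) t :
  X a b c z -> z.1 q = 0 -> a q <= n%:R * b t ->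
  X a b c (z + 1 *: unitQ q + n%:R *: unitT t).
Proof.
move=> /arc_setP [zx zy zs] zq aqn; apply/arc_setP; split.
- move=> r; rewrite /= !ffunE scaler0 addr0.
  have [->|_] := eqVneq r q; last by rewrite scaler0 addr0.
  by right; rewrite zq scale1r add0r.
- move=> s; rewrite /= !ffunE scaler0 addr0; apply: rpredD => //.
  by rewrite scaler_nat rpredMn // natr_nat.
- by rewrite slackD_unitT slackD_unitQ mul1r -addrA addr_ge0 // addrC subr_ge0.
Qed.

Lemma arc_set_trade z (n : nat) t k :
  X a b c z -> z.2 t != 0 :> R -> b t <= n%:R * b k ->
  X a b c (z + -1 *: unitT t + n%:R *: unitT k).
Proof.
move=> /arc_setP [zx zy zs] zt btn; apply/arc_setP; split.
- by move=> q; rewrite /= !ffunE !scaler0 !addr0.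
- move=> s; rewrite /= !ffunE; apply: rpredD; last first.
    by rewrite scaler_nat rpredMn // natr_nat.
  have [->|_] := eqVneq s t; last by rewrite scaler0 addr0.
  (* A nonzero natural number stays natural when 1 is subtracted. *)
  move: zt; have /natrP [[|j] ->] := zy t; first by rewrite eqxx.
  by rewrite scaleN1r -addn1 natrD addrK natr_nat.
- rewrite !slackD_unitT mulN1r -addrA addr_ge0 //.
  by rewrite addrC subr_ge0.
Qed.

(** Some multiple [n e_t] of a unit vector lies in [X], and so do
    [n e_t + e_s] for every [s] and, for [j] large enough, [n e_t + e_q + j e_t]
    for every [q]: enough points to read off every coefficient. *)
Lemma slack0_coef (t0 : 'I_m) alpha beta gamma : (forall q, 0 < a q) ->
  (forall z, X a b c z -> slack alpha beta gamma z = 0) ->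
  [/\ forall q, alpha q = 0, forall t, beta t = 0 & gamma = 0].
Proof.
move=> a_gt0 s0; have [n Xn] := arc_set_base t0.
have beta0 t : beta t = 0.
  have := s0 _ (arc_set_unitT 1 t Xn).
  by rewrite slackD_unitT (s0 _ Xn) add0r mul1r.
split=> // [q|].
  have [j [_ aj]] := ceil_ratio_nat (ltW (a_gt0 q)) (b_gt0 t0).
  have nq : (n%:R *: unitT t0 : Defs.space R Q m).1 q = 0.
    by rewrite /= !ffunE scaler0.
  have /eqP := s0 _ (arc_set_insert Xn nq aj).
  rewrite slackD_unitT slackD_unitQ (s0 _ Xn) beta0 mulr0 addr0 mul1r sub0r.
  by rewrite oppr_eq0 => /eqP.
have := s0 _ Xn.
by rewrite -[_ *: _]add0r slackD_unitT slack_at0 beta0 mulr0 addr0.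
Qed.

End ArcSet.

(** * Tight points of a facet *)

Section Facet.
Context {R : realType} {Q : finType} {m : nat}.
Variables (a : Q -> R) (b : 'I_m -> R) (c : R).
Hypothesis a_gt0 : forall q, 0 < a q.
Hypothesis b_gt0 : forall t, 0 < b t.
Variables (alpha : Q -> R) (beta : 'I_m -> R) (gamma : R).
Hypothesis facet : facet_defining a b c alpha beta gamma.
Implicit Types (z : Defs.space R Q m).

Let sl : Defs.space R Q m -> R := slack alpha beta gamma.

Lemma facet_slack_ge0 z : X a b c z -> 0 <= sl z.
Proof. by move=> /arc_set_sub_hull; rewrite /sl slack_ge0; apply: facet.1. Qed.

Lemma facetP z : face a b c alpha beta gamma z <-> P a b c z /\ sl z = 0.
Proof.
split=> [] [Pz].
  by move=> /eqP; rewrite -slack_eq0 => /eqP.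
by move=> /eqP; rewrite slack_eq0 => /eqP.
Qed.

Lemma facet_slack_neq0 : exists2 z, P a b c z & sl z != 0.
Proof.
have [_ [d [dimP dimF]]] := facet.
apply: contrapT => no; apply: (aff_dim_proper dimP dimF) => z Pz.
by apply/facetP; split=> //; apply: contrapT => /eqP sz; apply: no; exists z.
Qed.

(** A tight point of the hull is a combination of tight points of [X]: the
    slacks of the points combined are nonnegative and average to 0. *)
Lemma hull_slack0 alpha' beta' gamma' z :
  (forall w, X a b c w -> sl w = 0 -> slack alpha' beta' gamma' w = 0) ->
  P a b c z -> sl z = 0 -> slack alpha' beta' gamma' z = 0.
Proof.
move=> tight [n [l [p [l_ge0 l1 Xp ->]]]]; rewrite /sl !slack_conv // => lsl0.
apply: big1 => i _.
have /(_ i isT) /eqP : forall i, true -> l i * sl (p i) = 0.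
  by apply: psumr_eq0P lsl0 => j _; rewrite mulr_ge0 // facet_slack_ge0.
by rewrite mulf_eq0 => /orP [/eqP -> | /eqP /(tight _ (Xp i)) ->];
  rewrite ?mul0r ?mulr0.
Qed.

(** A facet determines its inequality, so a valid inequality that is not a
    multiple of it must be strict at some tight point of [X]. *)
Lemma facet_tight_point (t0 : 'I_m) alpha' beta' gamma' :
  (forall z, X a b c z -> 0 <= slack alpha' beta' gamma' z) ->
  (exists2 z, X a b c z & slack alpha' beta' gamma' z != 0) ->
  ~ positive_multiple alpha beta gamma alpha' beta' gamma' ->
  exists z, [/\ X a b c z, sl z = 0 & slack alpha' beta' gamma' z != 0].
Proof.
move=> sl'_ge0 [w Xw w0] notmul; apply: contrapT => no; apply: notmul.
have [_ [d [dimP dimF]]] := facet.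
have tight z : P a b c z -> sl z = 0 -> slack alpha' beta' gamma' z = 0.
  apply: hull_slack0 => v Xv v0.
  by apply: contrapT => /eqP v0'; apply: no; exists v.
have prop p p' : P a b c p -> P a b c p' ->
    sl p * slack alpha' beta' gamma' p' = slack alpha' beta' gamma' p * sl p'.
  move=> Pp Pp'.
  have hyperplane z : face a b c alpha beta gamma z <->
      P a b c z /\ slack_form alpha beta z = - gamma.
    rewrite facetP /sl /slack.
    by split=> -[Pz /eqP zE]; split=> //; apply/eqP; rewrite addr_eq0 in zE *.
  have tight' z : face a b c alpha beta gamma z ->
      slack_form alpha' beta' z = - gamma'.
    by move=> /facetP [Pz /(tight _ Pz) /eqP]; rewrite addr_eq0 => /eqP.
  have := affine_forms_proportional dimP dimF hyperplane tight' Pp Pp'.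
  by rewrite !opprK.
have [p Pp p0] := facet_slack_neq0.
have Pw := arc_set_sub_hull Xw.
have w'_gt0 : 0 < slack alpha' beta' gamma' w by rewrite lt0r w0 sl'_ge0.
have w_gt0 : 0 < sl w.
  rewrite lt0r (facet_slack_ge0 Xw) andbT; apply/eqP => w00.
  by have := mulf_neq0 p0 w0; rewrite prop // w00 mulr0 eqxx.
(* Proportionality to the slack at [w] gives the factor; it is positive as both
   slacks are. *)
pose k := sl w / slack alpha' beta' gamma' w.
have [alpha0 beta0 gamma0] : [/\ forall q, alpha q - k * alpha' q = 0,
    forall t, beta t - k * beta' t = 0 & gamma - k * gamma' = 0].
  apply: (slack0_coef (c := c) b_gt0 t0) => // z Xz.
  rewrite slackB /k mulrAC (prop w z Pw (arc_set_sub_hull Xz)).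
  by rewrite mulrAC divff // mul1r subrr.
exists k; first exact: divr_gt0.
by split=> *; apply/eqP; rewrite -subr_eq0 ?alpha0 ?beta0 ?gamma0.
Qed.

End Facet.

(** * Coefficients of a nontrivial facet *)

Theorem proposition4 (R : realType) (Q : finType) (m : nat)
  (a : Q -> R) (b : 'I_m -> R) (c : R)
  (m_gt0 : (0 < m)%N)
  (b_gt0 : forall t, 0 < b t)
  (b_sorted : forall s t : 'I_m, (s <= t)%N -> b s <= b t)
  (a_gt0 : forall q, 0 < a q)
  (ac_gt0 : 0 < \sum_q a q - c)
  (alpha : Q -> R) (beta : 'I_m -> R) (gamma : R)
  (facet : facet_defining a b c alpha beta gamma)
  (nontrivial : ~ trivial_inequality a b c alpha beta gamma) :
  [/\ (* (i) *)
      forall (q : Q) (t : 'I_m),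
        0 <= alpha q /\ alpha q <= (Num.ceil (a q / b t))%:~R * beta t,
      (* (ii) *)
      forall t k : 'I_m, t <> k ->
        0 < beta t /\ beta t <= (Num.ceil (b t / b k))%:~R * beta k
    & (* (iii) *)
      (0 <= c -> 0 <= gamma) /\
      (c < 0 -> forall t : 'I_m,
         - ((Num.ceil (- c / b t))%:~R * beta t) <= gamma)].
Proof.
pose t0 := Ordinal m_gt0.
have slack_ge0 z : X a b c z -> 0 <= slack alpha beta gamma z.
  exact: facet_slack_ge0.
have tight_point := facet_tight_point a_gt0 b_gt0 facet t0.
have [n Xn] := arc_set_base a c b_gt0 t0.
have nq q : (n%:R *: unitT t0 : Defs.space R Q m).1 q = 0.
  by rewrite /= !ffunE scaler0.
(* Where no tight point existed, the inequality would be [x_q >= 0],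
   [x_q <= 1] or [y_t >= 0] respectively. *)
have tight_x1 q : exists z,
    [/\ X a b c z, slack alpha beta gamma z = 0 & z.1 q = 1].
  have [z Xz|||z [Xz z0]] := tight_point (fun r => - (r == q)%:R) (fun=> 0) 0.
  - by rewrite slack_x_ge0; have /arc_setP [/(_ q) [] ->] := Xz.
  - have [j [_ aj]] := ceil_ratio_nat (ltW (a_gt0 q)) (b_gt0 t0).
    exists (n%:R *: unitT t0 + 1 *: unitQ q + j%:R *: unitT t0).
      exact: arc_set_insert.
    by rewrite slackD_unitT slackD_unitQ slack_x_ge0 nq eqxx mulr0 addr0
      mulrN mulr1 opprK add0r oner_neq0.
  - by move=> mul; apply: nontrivial; apply: Or41; exists q.
  - rewrite slack_x_ge0 => zq; exists z; split=> //.
    by have /arc_setP [/(_ q) [zq0|//]] := Xz; rewrite zq0 eqxx in zq.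
have tight_x0 q : exists z,
    [/\ X a b c z, slack alpha beta gamma z = 0 & z.1 q = 0].
  have [z Xz|||z [Xz z0]] := tight_point (fun r => (r == q)%:R) (fun=> 0) 1.
  - by rewrite slack_x_le1; have /arc_setP [/(_ q) [] -> _ _] := Xz;
      rewrite ?subrr ?subr0.
  - by exists (n%:R *: unitT t0) => //; rewrite slack_x_le1 nq subr0 oner_neq0.
  - by move=> mul; apply: nontrivial; apply: Or42; exists q.
  - rewrite slack_x_le1 => zq; exists z; split=> //.
    by have /arc_setP [/(_ q) [//|zq1]] := Xz; rewrite zq1 subrr eqxx in zq.
have tight_y t : exists z,
    [/\ X a b c z, slack alpha beta gamma z = 0 & z.2 t != 0 :> R].
  have [z Xz|||z [Xz z0]] := tight_point (fun=> 0) (fun s => (s == t)%:R) 0.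
  - by rewrite slack_y_ge0; have /arc_setP [_ /(_ t) /natr_ge0] := Xz.
  - exists (n%:R *: unitT t0 + 1%:R *: unitT t); first exact: arc_set_unitT.
    rewrite slackD_unitT slack_y_ge0 eqxx /= !ffunE mulr1 gt_eqF //.
    by rewrite ltr_wpDl // scaler_nat mulrn_wge0.
  - by move=> mul; apply: nontrivial; apply: Or43; exists t.
  - by rewrite slack_y_ge0 => zt; exists z.
(* As the slack at a tight point is 0, the bound says that it stays nonnegative
   after the move. *)
have alpha_ge0 q : 0 <= alpha q.
  have [z [Xz z0 zq]] := tight_x1 q.
  have := slack_ge0 _ (arc_set_remove (a_gt0 q) Xz zq).
  by rewrite slackD_unitQ z0; lra.
have alpha_le q t : alpha q <= (Num.ceil (a q / b t))%:~R * beta t.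
  have [z [Xz z0 zq]] := tight_x0 q.
  have [j [-> aj]] := ceil_ratio_nat (ltW (a_gt0 q)) (b_gt0 t).
  have := slack_ge0 _ (arc_set_insert Xz zq aj).
  by rewrite slackD_unitT slackD_unitQ z0; lra.
have beta_le t k : t <> k -> beta t <= (Num.ceil (b t / b k))%:~R * beta k.
  move=> tk; have [z [Xz z0 zt]] := tight_y t.
  have [j [-> bj]] := ceil_ratio_nat (ltW (b_gt0 t)) (b_gt0 k).
  have := slack_ge0 _ (arc_set_trade Xz zt bj).
  by rewrite !slackD_unitT z0; lra.
have beta_ge0 t : 0 <= beta t.
  have [z [Xz z0 _]] := tight_y t.
  have := slack_ge0 _ (arc_set_unitT b_gt0 1 t Xz).
  by rewrite slackD_unitT z0 add0r mul1r.
(* Otherwise all coefficients vanish, and the slack is constant: it is 0 on the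
   facet, hence on all of [P]. *)
have beta_neq0 t : beta t != 0.
  apply/eqP => bt0.
  have alpha0 q : alpha q = 0.
    by apply/eqP; rewrite eq_le alpha_ge0 andbT;
      have := alpha_le q t; rewrite bt0 mulr0.
  have beta0 k : beta k = 0.
    have [->//|/eqP kt] := eqVneq k t.
    by apply/eqP; rewrite eq_le beta_ge0 andbT;
      have := beta_le k t kt; rewrite bt0 mulr0.
  have slackE z : slack alpha beta gamma z = gamma.
    rewrite /slack /slack_form !big1 ?subrr ?add0r // => i _.
      by rewrite alpha0 mul0r.
    by rewrite beta0 mul0r.
  have [z [_ z0 _]] := tight_y t.
  have [p _] := facet_slack_neq0 facet.
  by rewrite slackE -(slackE z) z0 eqxx.
split=> [q t|t k tk|]; first by split.
  by rewrite lt0r beta_neq0 beta_ge0; split=> //; apply: beta_le.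
split=> [c_ge0|c_lt0 t].
  by have := slack_ge0 _ (arc_set0 a b c_ge0); rewrite slack_at0.
have Nc_ge0 : 0 <= - c by lra.
have [j [-> cj]] := ceil_ratio_nat Nc_ge0 (b_gt0 t).
have := slack_ge0 _ (arc_set_multiple a cj).
by rewrite -[_ *: _]add0r slackD_unitT slack_at0; lra.
Qed.
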